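(* Let $L$ be an infinite regular language with a pruned, weighted automaton $\Gamma$. Let $A$ be the adjacency matrix of $\Gamma$, and let $\rho_A$ be its Perron--Frobenius eigenvalue. Then $$\lim_{n\to\infty}\sqrt[n]{w(L_{\le n})} = \max\{\rho_A,\,1\}$$ (in particular the limit exists).
   Context: An alphabet is a finite set $S$; a word is a finite sequence of letters of $S$; a language is a set of words. A finite state automaton $\Gamma$ over $S$ is a finite directed graph with edges labeled by elements of $S$, with one vertex declared the start state and some vertices declared accept states. All automata are deterministic: no vertex has two outgoing edges with the same label. A word is accepted if it is read along a directed path from the start state to an accept state; the language of $\Gamma$ is the set of accepted words, and a language is regular if it arises in this way. $\Gamma$ is pruned if every vertex is traversed by some directed path from the start state to an accept state. $\Gamma$ is weighted if its edges carry positive real weights. The weight of a path is the product of the weights of its edges, with multiplicity, and the weight of an accepted word is the weight of the corresponding path. The adjacency matrix $A$ has $A_{ij}$ equal to the total weight of the edges from vertex $v_i$ to vertex $v_j$ ($0$ if there are none). For a non-negative square matrix $A$, $\rho_A$ is the largest absolute value of an eigenvalue of $A$ (itself an eigenvalue). $L_{\le n}$ is the set of words of $L$ of length at most $n$, and $w(L_{\le n})$, also written $f_L(n)$, is the total weight of all words in $L_{\le n}$. *)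

(* Defs.v *)
From mathcomp Require Import all_boot all_order all_algebra.
From mathcomp Require Import all_classical all_reals all_analysis.
From mathcomp Require Import complex.

Set Implicit Arguments.
Unset Strict Implicit.
Unset Printing Implicit Defensive.

Import Order.TTheory GRing.Theory Num.Theory.
Import numFieldNormedType.Exports.

Local Open Scope classical_set_scope.
Local Open Scope ring_scope.
Local Open Scope complex_scope.

Record automaton (S : finType) := Automaton {
  vertex : finType;
  edge : finType;
  src : edge -> vertex;
  dst : edge -> vertex;
  label : edge -> S;
  start : vertex;
  accept : {set vertex};
  deterministic : forall e e' : edge,
    src e = src e' -> label e = label e' -> e = e' }.

Record weighted_automaton (R : realType) (S : finType) := WeightedAutomaton {
  underlying :> automaton S;
  weight : edge underlying -> R;
  weight_gt0 : forall e, 0 < weight e }.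

Section Paths.
Variables (S : finType) (G : automaton S).

(* A path issued from v is given by its sequence of edges; it is empty when it
   stays at v. *)
Fixpoint is_path (v : vertex G) (p : seq (edge G)) : bool :=
  if p is e :: p' then (src e == v) && is_path (dst e) p' else true.

Definition path_end (v : vertex G) (p : seq (edge G)) : vertex G :=
  last v (map (@dst S G) p).

Definition accepting_path (p : seq (edge G)) : bool :=
  is_path (start G) p && (path_end (start G) p \in accept G).

Definition reads (p : seq (edge G)) (w : seq S) : bool :=
  map (@label S G) p == w.

Definition language : set (seq S) :=
  [set w | exists2 p, accepting_path p & reads p w].

Definition pruned : Prop :=
  forall v : vertex G, exists2 p,
    accepting_path p & v \in start G :: map (@dst S G) p.

Lemma path_unique v p q :
  is_path v p -> is_path v q ->
  map (@label S G) p = map (@label S G) q -> p = q.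
Proof.
elim: p v q => [|e p IHp] v [|f q] //= /andP[/eqP se pp] /andP[/eqP sf pq].
move=> [elab plab].
have ef : e = f by apply: deterministic; rewrite ?se ?sf.
by rewrite ef in pp *; rewrite (IHp _ _ pp pq plab).
Qed.

End Paths.

Definition language_le (S : finType) (L : set (seq S)) (n : nat) :
  set (seq S) := [set w | L w /\ (size w <= n)%N].

(* Hence the finitely supported sum in total_weight below is a genuine one. *)
Lemma finite_language_le (S : finType) (L : set (seq S)) (n : nat) :
  finite_set (language_le L n).
Proof.
pose T := {k : 'I_n.+1 & k.-tuple S}.
apply: (@sub_finite_set _ _ [set (val (tagged t) : seq S) | t in [set: T]]);
  last exact/finite_image/finite_finset.
move=> w [_ wn]; have ltn : (size w < n.+1)%N by [].
by exists (Tagged (fun k : 'I_n.+1 => k.-tuple S)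
                  (in_tuple w : (Ordinal ltn).-tuple S)).
Qed.

Section Weights.
Variables (R : realType) (S : finType) (G : weighted_automaton R S).

Definition path_weight (p : seq (edge G)) : R := \prod_(e <- p) weight e.

(* The accepting path reading w is unique by path_unique; words that are not
   accepted get weight 0. *)
Definition word_weight (w : seq S) : R :=
  if [pick p : (size w).-tuple (edge G) | accepting_path p && reads p w]
  is Some p then path_weight p else 0.

Definition total_weight (L : set (seq S)) (n : nat) : R :=
  \sum_(w \in language_le L n) word_weight w.

(* enum_val i is the i-th vertex of G. *)
Definition adjacency : 'M[R]_#|vertex G| :=
  \matrix_(i, j) \sum_(e | (src e == enum_val i) && (dst e == enum_val j))
    weight e.

End Weights.

(* The eigenvalues are taken in the complex numbers R[i]. For m > 0 they form a
   finite nonempty set, so that the supremum is a maximum. *)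
Definition spectral_radius (R : realType) (m : nat) (A : 'M[R]_m) : R :=
  sup [set ComplexField.Normc.normc z
      | z in [set z : R[i] | eigenvalue (map_mx (real_complex R) A) z]].

(* Main.v *)
Require Import Defs.
From mathcomp Require Import all_boot all_order all_algebra.
From mathcomp Require Import all_classical all_reals all_analysis.
From mathcomp Require Import complex.
From mathcomp Require Import ring.
Import Order.TTheory GRing.Theory Num.Theory.
Import numFieldNormedType.Exports.
Local Open Scope classical_set_scope.
Local Open Scope ring_scope.

(** Write f n for the total weight of the words of length at most n. Since the
    automaton is deterministic, words of the language correspond to accepting
    paths, so f n is the sum over k <= n, and over the accept states v, of the
    entries (A ^+ k) start v of the powers of the adjacency matrix A
    [adjacencyX, total_weightE]. The growth of f is then compared with that of
    the powers of A, in both directions.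

    Upper bound. For every r > rho_A each entry of A ^+ k is O(r ^+ k)
    [power_growth]. Indeed, by the Cayley-Hamilton theorem the sequence of the
    powers of A is annihilated by the product of the operators E - z, where E
    is the shift and z runs over the eigenvalues with multiplicity, and
    inverting one factor at a time preserves the bound O(r ^+ k) because
    |z| < r [geometric_growth]. Summation over k <= n is itself the inversion of the
    factor E - 1, so the same lemma gives f n = O(r ^+ n) whenever
    r > max(rho_A, 1).

    Lower bound. As the automaton is pruned, a path of length k between any
    two states extends to an accepting path, by a detour whose length and
    weight do not depend on k; hence every entry of A ^+ k is at most
    K * f (k + N) for constants K and N [path_sum_le_shifted_total]. Applying
    A ^+ k to an eigenvector for z bounds |z| ^+ k by a fixed combination of
    these entries [eigenvalueX_le], whence f n >= c * |z| ^+ n for large n,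
    with c > 0. Also f is nondecreasing and eventually positive, so that
    f n >= c * 1 ^+ n for large n, which accounts for the 1 in the maximum.

    Multiplicative constants disappear in the n-th root
    [near_root_ge, near_root_le], and rho_A is the supremum of the moduli |z|.
    *)

(** * Geometric sequences and n-th roots *)

Lemma near_geometric_le (R : realType) (a b C : R) :
  0 <= a -> a < b -> \forall n \near \oo, C * a ^+ n <= b ^+ n.
Proof.
move=> a0 ab; have b0 : 0 < b := le_lt_trans a0 ab.
have q1 : `|a / b| < 1.
  by rewrite ger0_norm ?ltr_pdivrMr ?mul1r// divr_ge0// ltW.
have /cvgrPdist_le/(_ 1 ltr01) := cvg_geometric C q1.
apply: filterS => n; rewrite sub0r normrN /= => /(le_trans (ler_norm _)).
by rewrite expr_div_n mulrA ler_pdivrMr ?exprn_gt0// mul1r.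
Qed.

Lemma expr_rootK (R : realType) (y : R) n :
  0 <= y -> (0 < n)%N -> (y ^+ n) `^ n%:R^-1 = y.
Proof.
move=> y0 n0; rewrite -powR_mulrn// -powRrM mulfV ?powRr1//.
by rewrite pnatr_eq0 -lt0n.
Qed.

(** The gap y < x absorbs the constant c: the inequality c * x ^+ n >= y ^+ n,
    for y >= 0, holds for large n however small c is. *)
Lemma near_root_ge (R : realType) (f : nat -> R) (c x y : R) :
  0 <= x -> 0 < c -> y < x -> (\forall n \near \oo, c * x ^+ n <= f n) ->
  \forall n \near \oo, y <= f n `^ n%:R^-1.
Proof.
move=> x0 c0 yx fx.
have [y0|y0] := leP 0 y; last by near=> n; rewrite (le_trans (ltW y0))// powR_ge0.
near=> n; have n0 : (0 < n)%N by near: n; exists 1%N.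
rewrite -[leLHS](@expr_rootK _ _ n)// ge0_ler_powR ?invr_ge0 ?ler0n//.
- by rewrite nnegrE exprn_ge0.
- rewrite nnegrE; apply: (@le_trans _ _ (c * x ^+ n)); last by near: n.
  by rewrite mulr_ge0 ?exprn_ge0// ltW.
- apply: (@le_trans _ _ (c * x ^+ n)); last by near: n.
  rewrite -ler_pdivrMl//.
  by near: n; exact: near_geometric_le.
Unshelve. all: by end_near. Qed.

Lemma near_root_le (R : realType) (f : nat -> R) (C r y : R) :
  0 <= r -> r < y -> (forall n, 0 <= f n <= C * r ^+ n) ->
  \forall n \near \oo, f n `^ n%:R^-1 <= y.
Proof.
move=> r0 ry fr; near=> n; have n0 : (0 < n)%N by near: n; exists 1%N.
have y0 : 0 <= y by rewrite (le_trans r0) ?ltW.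
have /andP[fn0 fnr] := fr n.
rewrite -[leRHS](@expr_rootK _ _ n)// ge0_ler_powR ?invr_ge0 ?ler0n//.
- by rewrite nnegrE exprn_ge0.
- by apply: (le_trans fnr); near: n; exact: near_geometric_le.
Unshelve. all: by end_near. Qed.

(** The perturbation C * r ^+ k grows strictly faster than the solutions of the
    homogeneous recurrence, so it dictates the growth of v. *)
Lemma geometric_growth (R : realFieldType) (v : nat -> R) (a r C : R) :
  0 <= a -> a < r -> (forall k, v k.+1 <= a * v k + C * r ^+ k) ->
  exists D, forall k, v k <= D * r ^+ k.
Proof.
move=> a0 ar vS; have ra0 : 0 < r - a by rewrite subr_gt0.
(* The induction closes exactly when a * D + C <= D * r. *)
pose D := Num.max (v 0%N) (C / (r - a)).
have CD : C <= D * (r - a) by rewrite -ler_pdivrMr// le_max lexx orbT.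
exists D; elim=> [|k IHk]; first by rewrite mulr1 le_max lexx.
have rk0 : 0 <= r ^+ k by rewrite exprn_ge0// (le_trans a0)// ltW.
apply: (le_trans (vS k)); apply: (@le_trans _ _ ((a * D + C) * r ^+ k)).
  by rewrite mulrDl lerD2r -mulrA ler_wpM2l.
rewrite exprS mulrA ler_wpM2r// -lerBrDl (le_trans CD)//.
by rewrite mulrBr [a * D]mulrC.
Qed.

(** * Powers of a complex matrix and its eigenvalues *)

Local Notation normc := ComplexField.Normc.normc.

Lemma normc_ge0 (R : rcfType) (z : R[i]) : 0 <= normc z.
Proof. by case: z => a b; exact: sqrtr_ge0. Qed.

Lemma normc_real (R : rcfType) (x : R) : normc x%:C%C = `|x|.
Proof. by rewrite /normc /= expr0n addr0 sqrtr_sqr. Qed.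

Lemma normcX (R : rcfType) (z : R[i]) n : normc (z ^+ n) = normc z ^+ n.
Proof.
elim: n => [|n IHn]; first exact: ComplexField.Normc.normc1.
by rewrite !exprS ComplexField.Normc.normcM IHn.
Qed.

Lemma normc_sum (R : rcfType) (I : finType) (F : I -> R[i]) :
  normc (\sum_i F i) <= \sum_i normc (F i).
Proof.
elim/big_ind2: _ => [|x a y b xa yb|//].
  by rewrite ComplexField.Normc.normc0.
exact: le_trans (le_normcD _ _) (lerD xa yb).
Qed.

(** The part of Gelfand's formula that bounds the powers of A from above. *)
Lemma power_growth (R : realType) m (A : 'M[R[i]]_m) (r : R) :
  (forall z, eigenvalue A z -> normc z < r) ->
  forall i j, exists D, forall k, normc ((A ^+ k) i j) <= D * r ^+ k.
Proof.
case: m A => [|m] A eigr i j; first by case: i.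
have [s char_s] := closed_field_poly_normal (char_poly A).
rewrite (monicP (char_poly_monic A)) scale1r in char_s.
have {eigr} sr z : z \in s -> normc z < r.
  by move=> zs; apply: eigr; rewrite eigenvalue_root_char char_s root_prod_XsubC.
(* The polynomial q holds the factors of the characteristic polynomial that
   have been peeled off; once all are in q, Cayley-Hamilton makes u vanish. *)
pose u q k := horner_mx A (q * 'X^k) i j.
suff bound t q : (forall z, z \in t -> normc z < r) ->
    horner_mx A (q * \prod_(z <- t) ('X - z%:P)) = 0 ->
    exists D, forall k, normc (u q k) <= D * r ^+ k.
  have [|D uD] := bound s 1 sr; first by rewrite mul1r -char_s Cayley_Hamilton.
  exists D => k; rewrite (le_trans _ (uD k))// /u mul1r.
  by rewrite rmorphXn /= horner_mx_X.
elim: t q => [|z t IHt] q tr qt0.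
  exists 0 => k; rewrite /u rmorphM /=; move: qt0; rewrite big_nil mulr1 => ->.
  by rewrite mul0r mxE ComplexField.Normc.normc0 mul0r.
have [||C uC] := IHt (q * ('X - z%:P)).
- by move=> y yt; apply: tr; rewrite inE yt orbT.
- by move: qt0; rewrite big_cons mulrA.
apply: (@geometric_growth _ (fun k => normc (u q k)) (normc z) r C).
- exact: normc_ge0.
- by apply: tr; rewrite mem_head.
(* Multiplying q by 'X - z turns u into its shift minus z times itself. *)
move=> k; have -> : u q k.+1 = z * u q k + u (q * ('X - z%:P)) k.
  rewrite /u; have -> : q * 'X^(k.+1) = z *: (q * 'X^k) + q * ('X - z%:P) * 'X^k.
    by rewrite exprS -mul_polyC; ring.
  by rewrite linearD linearZ /= !mxE.
by rewrite -ComplexField.Normc.normcM (le_trans (le_normcD _ _))// lerD2l.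
Qed.

Lemma le_spectral_radius (R : realType) m (A : 'M[R]_m) z :
  eigenvalue (map_mx (real_complex R) A) z -> normc z <= spectral_radius A.
Proof.
move=> Az; pose B := map_mx (real_complex R) A.
have [s char_s] := closed_field_poly_normal (char_poly B).
rewrite (monicP (char_poly_monic B)) scale1r in char_s.
apply: sup_upper_bound; last by exists z.
(* Any upper bound of the moduli will do; their sum over the roots is one. *)
split; first by exists (normc z), z.
exists (\sum_(y <- s) normc y) => _ [y By <-].
have ys : y \in s.
  by move: By; rewrite /= eigenvalue_root_char -/B char_s root_prod_XsubC.
by rewrite (big_rem y)//= lerDl sumr_ge0// => w _; exact: normc_ge0.
Qed.

(** The hypothesis 0 <= x covers the matrix of size 0, which has no eigenvalue
    and whose spectral radius is then the supremum 0 of the empty set. *)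
Lemma spectral_radius_gt (R : realType) m (A : 'M[R]_m) x :
  0 <= x -> x < spectral_radius A ->
  exists2 z, eigenvalue (map_mx (real_complex R) A) z & x < normc z.
Proof.
rewrite /spectral_radius; set moduli := [set _ | _ in _] => x0 xA.
have [moduli0|/set0P moduliN0] := eqVneq moduli set0.
  by move: xA; rewrite moduli0 sup0 ltNge x0.
by have [_ [z zA <-] xz] := sup_gt moduliN0 xA; exists z.
Qed.

(** The j-th coordinate of v *m A ^+ k = z ^+ k *: v, for an eigenvector v with
    v 0 j != 0: this is the part of Gelfand's formula that bounds the powers of
    A from below. *)
Lemma eigenvalueX_le (R : realType) m (A : 'M[R[i]]_m) (z : R[i]) :
  eigenvalue A z -> exists j, exists2 K : 'I_m -> R, (forall i, 0 <= K i) &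
    forall k, normc z ^+ k <= \sum_i K i * normc ((A ^+ k) i j).
Proof.
move=> /eigenvalueP[v vA /rV0Pn[j vj]].
exists j, (fun i => normc (v 0 i) / normc (v 0 j)) => [i|k].
  by rewrite divr_ge0 ?normc_ge0.
have vAk : v *m A ^+ k = z ^+ k *: v.
  elim: k => [|k IHk]; first by rewrite mulmx1 scale1r.
  by rewrite exprSr mulmxA IHk -scalemxAl vA scalerA -exprSr.
have nvj : 0 < normc (v 0 j).
  rewrite lt_neqAle normc_ge0 andbT eq_sym.
  by apply: contra vj => /eqP/ComplexField.Normc.eq0_normc ->.
rewrite -(ler_pM2r nvj) -normcX -ComplexField.Normc.normcM.
have -> : z ^+ k * v 0 j = (v *m A ^+ k) 0 j by rewrite vAk mxE.
rewrite mxE (le_trans (normc_sum _ _ _))// mulr_suml ler_sum// => i _.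
by rewrite ComplexField.Normc.normcM mulrAC divfK ?gt_eqF.
Qed.

(** * Weights of paths and powers of the adjacency matrix *)

Section Automaton.
Variables (R : realType) (S : finType) (G : weighted_automaton R S).
Implicit Types (u v : vertex G) (p q : seq (edge G)) (w : seq S).

Lemma path_weight_gt0 p : 0 < path_weight p.
Proof. by apply: prodr_gt0 => e _; exact: weight_gt0. Qed.

Definition path_sum k u v : R :=
  \sum_(p : k.-tuple (edge G) | is_path u p && (path_end u p == v))
    path_weight p.

Lemma path_sum_ge0 k u v : 0 <= path_sum k u v.
Proof. by apply: sumr_ge0 => p _; exact/ltW/path_weight_gt0. Qed.

Lemma path_sum_gt0 u p : is_path u p -> 0 < path_sum (size p) u (path_end u p).
Proof.
move=> up; rewrite /path_sum (bigD1 (in_tuple p)) /= ?up ?eqxx//.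
rewrite ltr_wpDr ?path_weight_gt0//.
by apply: sumr_ge0 => q _; exact/ltW/path_weight_gt0.
Qed.

Lemma path_sumS k u v :
  path_sum k.+1 u v = \sum_(e | src e == u) weight e * path_sum k (dst e) v.
Proof.
pose cons_pair (x : edge G * k.-tuple (edge G)) := cons_tuple x.1 x.2.
rewrite /path_sum (reindex cons_pair) /=; last first.
  exists (fun t => (thead t, behead_tuple t)) => [[e t] _|t _].
    by congr pair; exact: val_inj.
  by rewrite /cons_pair /= [t in RHS]tuple_eta; exact: val_inj.
under [RHS]eq_bigr do rewrite mulr_sumr.
rewrite pair_big_dep; apply: eq_big => [[e t]|[e t] _] /=.
  by rewrite andbA.
by rewrite /path_weight big_cons.
Qed.

Lemma path_sum0 u v : path_sum 0 u v = (u == v)%:R.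
Proof.
rewrite /path_sum big_mkcond (bigD1 [tuple]) //= big1 ?addr0.
  by rewrite /path_weight big_nil /path_end /=; case: (u == v).
by move=> p; rewrite tuple0.
Qed.

Lemma adjacencyX k i j :
  (adjacency G ^+ k) i j = path_sum k (enum_val i) (enum_val j).
Proof.
elim: k i => [|k IHk] i; first by rewrite mxE path_sum0 (inj_eq enum_val_inj).
rewrite exprS mxE path_sumS (partition_big (fun e => enum_rank (dst e)) xpredT)//=.
apply: eq_bigr => l _; rewrite mxE IHk mulr_suml; apply: eq_big => [e|e].
  by rewrite -(inj_eq enum_val_inj) enum_rankK.
by case/andP=> _ /eqP ->.
Qed.

(** Concatenating a path from u to x with a path from x to v: the right-hand
    side also counts the paths that are not at x after k steps. *)
Lemma path_sumM k l u v x :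
  path_sum k u x * path_sum l x v <= path_sum (k + l) u v.
Proof.
rewrite -[u]enum_rankK -[v]enum_rankK -[x]enum_rankK -!adjacencyX exprD mxE.
rewrite (bigD1 (enum_rank x)) //= lerDl sumr_ge0// => i _.
by rewrite mulr_ge0 ?adjacencyX ?path_sum_ge0.
Qed.

Lemma is_path_cat u p q :
  is_path u (p ++ q) = is_path u p && is_path (path_end u p) q.
Proof. by elim: p u => [|e p IHp] u //=; rewrite IHp andbA. Qed.

Lemma path_end_cat u p q : path_end u (p ++ q) = path_end (path_end u p) q.
Proof. by rewrite /path_end map_cat last_cat. Qed.

Lemma path_split u v p : v \in u :: map (@dst S G) p ->
  exists p1 p2, p = p1 ++ p2 /\ path_end u p1 = v.
Proof.
elim: p u => [|e p IHp] u; first by rewrite inE => /eqP ->; exists [::], [::].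
rewrite inE => /orP[/eqP ->|/IHp[p1 [p2 [-> <-]]]].
  by exists [::], (e :: p).
by exists (e :: p1), p2.
Qed.

Lemma pruned_path_sum_gt0 v : pruned G ->
  exists a b t, [/\ t \in accept G, 0 < path_sum a (start G) v &
    0 < path_sum b v t].
Proof.
move=> /(_ v)[p /andP[sp pt]] /path_split[p1 [p2 [pE vE]]].
move: sp pt; rewrite pE is_path_cat path_end_cat vE => /andP[sp1 vp2] tacc.
exists (size p1), (size p2), (path_end v p2); split=> //.
  by rewrite -vE path_sum_gt0.
exact: path_sum_gt0.
Qed.

(** * The total weight as a sum over accepting paths *)

(** Determinism makes the path reading w unique, so the sum has at most one
    term. *)
Lemma word_weightE w :
  word_weight G w =
  \sum_(p : (size w).-tuple (edge G) | accepting_path p && reads p w)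
    path_weight p.
Proof.
rewrite /word_weight; case: pickP => [p /andP[pacc pw]|no]; last by rewrite big_pred0.
rewrite (big_pred1 p)// => q; apply/idP/eqP => [/andP[qacc qw]|->]; last exact/andP.
apply: val_inj; apply: (path_unique (v := start G)).
- by case/andP: qacc.
- by case/andP: pacc.
- by rewrite (eqP qw) (eqP pw).
Qed.

Lemma word_weight_notin w : ~ language G w -> word_weight G w = 0.
Proof.
move=> nLw; rewrite word_weightE big_pred0// => p.
by apply/negP => /andP[pacc pw]; apply: nLw; exists p.
Qed.

(** Every accepting path of length k reads exactly one word of length k. *)
Lemma sum_word_weight k :
  \sum_(t : k.-tuple S) word_weight G t =
  \sum_(v in accept G) path_sum k (start G) v.
Proof.
transitivity (\sum_(p : k.-tuple (edge G) | accepting_path p) path_weight p).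
  rewrite (partition_big (fun p : k.-tuple _ => map_tuple (@label S G) p) xpredT) //=.
  apply: eq_bigr => t _; rewrite word_weightE.
  case: t => w wk /=; have := wk => /eqP ek; subst k.
  by apply: eq_bigl => p; rewrite /reads -val_eqE.
rewrite (partition_big (fun p : k.-tuple _ => path_end (start G) p) [in accept G]) /=; last first.
  by move=> p /andP[].
apply: eq_bigr => v vacc; apply: eq_bigl => p; rewrite /accepting_path.
by case: eqP => [->|_]; rewrite ?vacc ?andbF ?andbT.
Qed.

Lemma total_weightE n :
  total_weight G (language G) n =
  \sum_(k < n.+1) \sum_(v in accept G) path_sum k (start G) v.
Proof.
(* The words of length at most n form a finite type, over which the sum can be
   taken as words outside the language have weight 0. *)
pose T := {k : 'I_n.+1 & k.-tuple S}.
pose word (x : T) : seq S := val (tagged x).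
have word_inj : injective word.
  move=> [[k ltk] t] [[l ltl] t'] /= tt'.
  have kl : k = l by have := congr1 size tt'; rewrite /word /= !size_tuple.
  subst l; rewrite (bool_irrelevance ltk ltl) in t tt' *.
  by congr Tagged; exact: val_inj.
rewrite /total_weight (fsbig_widen _ [set` map word (index_enum T)]); last 2 first.
- move=> w [_ wn]; have ltn : (size w < n.+1)%N by [].
  apply/mapP; exists (Tagged (fun k : 'I_n.+1 => k.-tuple S)
                  (in_tuple w : (Ordinal ltn).-tuple S)) => //.
  exact: mem_index_enum.
- move=> _ [/mapP[x _ ->] nL] /=; apply: word_weight_notin => Lx.
  apply: nL; split=> //; case: x {Lx} => k t /=.
  by rewrite size_tuple -ltnS.
rewrite -fsbig_seq; last by rewrite map_inj_uniq ?index_enum_uniq.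
rewrite big_map; under [RHS]eq_bigr do rewrite -sum_word_weight.
by rewrite sig_big_dep.
Qed.

Lemma total_weight_ge0 n : 0 <= total_weight G (language G) n.
Proof.
rewrite total_weightE; apply: sumr_ge0 => k _; apply: sumr_ge0 => v _.
exact: path_sum_ge0.
Qed.

Lemma path_sum_le_total k n v : (k <= n)%N -> v \in accept G ->
  path_sum k (start G) v <= total_weight G (language G) n.
Proof.
rewrite -ltnS => kn vacc; rewrite total_weightE (bigD1 (Ordinal kn))//=.
rewrite (bigD1 v)//= -addrA lerDl addr_ge0 ?sumr_ge0// => [w _|l _].
  exact: path_sum_ge0.
by apply: sumr_ge0 => w _; exact: path_sum_ge0.
Qed.

Lemma total_weightS n : total_weight G (language G) n.+1 =
  total_weight G (language G) n + \sum_(v in accept G) path_sum n.+1 (start G) v.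
Proof. by rewrite !total_weightE big_ord_recr. Qed.

Lemma total_weight_homo m n : (m <= n)%N ->
  total_weight G (language G) m <= total_weight G (language G) n.
Proof.
move=> /subnK <-; elim: (n - m)%N => // k /le_trans; apply.
rewrite total_weightS lerDl; apply: sumr_ge0 => v _; exact: path_sum_ge0.
Qed.

(** * Growth of the total weight *)

(** Prunedness provides a path of length a from the start state to u and a path
    of length b from v to some accept state, which complete any path from u to
    v to an accepting one. *)
Lemma path_sum_le_shifted_total u v : pruned G -> exists N, exists2 K, 0 < K &
  forall k, path_sum k u v <= K * total_weight G (language G) (k + N).
Proof.
move=> prG; have [a [_ [_ [_ su _]]]] := pruned_path_sum_gt0 u prG.
have [_ [b [t [tacc _ vt]]]] := pruned_path_sum_gt0 v prG.
exists (a + b)%N, (path_sum a (start G) u * path_sum b v t)^-1.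
  by rewrite invr_gt0 mulr_gt0.
move=> k; rewrite ler_pdivlMl ?mulr_gt0//.
rewrite addnCA addnA -addnA.
have := path_sum_le_total _ _ _ (leqnn (a + (k + b))) tacc.
apply: le_trans; apply: le_trans (path_sumM _ _ _ _ u).
rewrite -mulrA ler_wpM2l ?path_sum_ge0//.
by rewrite mulrC; exact: path_sumM.
Qed.

Lemma eigenvalueX_le_total z : pruned G ->
  eigenvalue (map_mx (real_complex R) (adjacency G)) z ->
  exists N, exists2 K, 0 < K & forall k,
    normc z ^+ k <= K * total_weight G (language G) (k + N).
Proof.
move=> prG /eigenvalueX_le[j [K K0 zK]].
(* The shift N depends on the entry, but as the total weight is nondecreasing
   finitely many shifts can be replaced by their sum. *)
pose dominated (g : nat -> R) := exists N, exists2 D, 0 < D &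
  forall k, g k <= D * total_weight G (language G) (k + N).
suff : dominated (fun k => \sum_i K i * path_sum k (enum_val i) (enum_val j)).
  move=> [N [D D0 le]]; exists N, D => // k.
  rewrite (le_trans (zK k))// (le_trans _ (le k))// ler_sum// => i _.
  rewrite -rmorphXn /= mxE adjacencyX normc_real ger0_norm ?path_sum_ge0//.
have dominatedD g h : dominated g -> dominated h -> dominated (g \+ h).
  move=> [M [C C0 gM]] [N [D D0 hN]]; exists (M + N)%N, (C + D) => [|k].
    exact: addr_gt0.
  rewrite mulrDl lerD// (le_trans (gM k), le_trans (hN k))// ler_pM2l//.
    by apply: total_weight_homo; rewrite addnA leq_addr.
  by apply: total_weight_homo; rewrite addnCA leq_addl.
elim: (index_enum _) => [|i s [N [D D0 IHs]]].
  by exists 0%N, 1 => // k; rewrite big_nil mul1r total_weight_ge0.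
have [||M [C C0 le]] :=
    dominatedD (fun k => K i * path_sum k (enum_val i) (enum_val j))
      (fun k => \sum_(i <- s) K i * path_sum k (enum_val i) (enum_val j)).
- have [M [C C0 le]] := path_sum_le_shifted_total (enum_val i) (enum_val j) prG.
  (* The summand 1 keeps the constant positive when K i = 0. *)
  exists M, (K i * C + 1) => [|k]; first by rewrite ltr_wpDl// mulr_ge0// ltW.
  rewrite mulrDl mul1r ler_wpDr ?total_weight_ge0//.
  by rewrite -mulrA ler_wpM2l.
- by exists N, D.
by exists M, C => // k; rewrite big_cons; exact: le.
Qed.

Lemma near_total_weight_root_ge1 y : pruned G -> y < 1 ->
  \forall n \near \oo, y <= total_weight G (language G) n `^ n%:R^-1.
Proof.
move=> prG y1; have [_ [b [t [tacc _ st]]]] := pruned_path_sum_gt0 (start G) prG.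
apply: (near_root_ge _ _ _ _ _ ler01 st y1); exists b => // n bn /=.
by rewrite expr1n mulr1 path_sum_le_total.
Qed.

Lemma near_total_weight_root_ge z y : pruned G ->
  eigenvalue (map_mx (real_complex R) (adjacency G)) z ->
  0 <= y -> y < normc z ->
  \forall n \near \oo, y <= total_weight G (language G) n `^ n%:R^-1.
Proof.
move=> prG zA y0 yz; have z0 := le_lt_trans y0 yz.
have [N [K K0 zK]] := eigenvalueX_le_total _ prG zA.
set x := normc z in yz z0 zK.
have c0 : 0 < (K * x ^+ N)^-1 by rewrite invr_gt0 mulr_gt0 ?exprn_gt0.
apply: (near_root_ge _ _ _ _ _ (ltW z0) c0 yz); exists N => // n /= Nn.
rewrite ler_pdivrMl ?mulr_gt0 ?exprn_gt0// -[in leLHS](subnK Nn) exprD.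
by rewrite mulrAC ler_pM2r ?exprn_gt0// (le_trans (zK _))// subnK.
Qed.

Lemma near_total_weight_root_le y :
  Num.max (spectral_radius (adjacency G)) 1 < y ->
  \forall n \near \oo, total_weight G (language G) n `^ n%:R^-1 <= y.
Proof.
move=> /midf_lt[]; set r := (_ + _) / _; rewrite gt_max => /andP[rhor r1] ry.
have growth v : exists D, forall k, path_sum k (start G) v <= D * r ^+ k.
  have [|D AD] := power_growth _ _ (map_mx (real_complex R) (adjacency G)) r _
    (enum_rank (start G)) (enum_rank v).
    by move=> z /le_spectral_radius/le_lt_trans; apply.
  exists D => k; have := AD k; rewrite -rmorphXn /= mxE normc_real.
  by rewrite adjacencyX !enum_rankK ger0_norm ?path_sum_ge0.
have [D sD] := choice growth.
(* The total weight satisfies a recurrence with multiplier a = 1. *)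
have [k|C fC] := geometric_growth _ (total_weight G (language G)) 1 r
    (r * \sum_(v in accept G) D v) ler01 r1.
  rewrite mul1r total_weightS lerD2l mulrAC -exprS mulr_sumr ler_sum// => v _.
  by rewrite mulrC.
apply: (near_root_le _ _ C r) => //; first by rewrite (le_trans ler01) ?ltW.
by move=> n; rewrite total_weight_ge0 fC.
Qed.

End Automaton.

Theorem theorem3p6 (R : realType) (S : finType) (L : set (seq S))
    (G : weighted_automaton R S)
    (L_infinite : infinite_set L)
    (L_language : language G = L)
    (G_pruned : pruned G) :
  (fun n : nat => total_weight G L n `^ (n%:R^-1)) @ \oo -->
    Num.max (spectral_radius (adjacency G)) 1.
Proof.
rewrite -L_language; set rho := spectral_radius _.
apply/cvgrPdist_le => e e0.
have lower : \forall n \near \oo,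
    Num.max rho 1 - e <= total_weight G (language G) n `^ n%:R^-1.
  have [lt1|ge1] := ltP (Num.max rho 1 - e) 1.
    exact: near_total_weight_root_ge1.
  have ltrho : Num.max rho 1 - e < rho.
    have : Num.max rho 1 - e < Num.max rho 1 by rewrite ltrBlDr ltrDl.
    by rewrite lt_max => /orP[//|]; rewrite ltNge ge1.
  have [z zA yz] := spectral_radius_gt _ _ _ _ (le_trans ler01 ge1) ltrho.
  exact: near_total_weight_root_ge zA (le_trans ler01 ge1) yz.
have upper : \forall n \near \oo,
    total_weight G (language G) n `^ n%:R^-1 <= Num.max rho 1 + e.
  by apply: near_total_weight_root_le; rewrite ltrDl.
near=> n; rewrite ler_distlC; apply/andP; split.
- by near: n.
- by near: n.
Unshelve. all: by end_near. Qed.
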